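(* Let $B$ be a basis and let $\nu_i$ ($i=1,\dots,m$) be the eigenvalues of $E_B=A_B^{-1}D_B$. The matrix $A_B+\lambda D_B$ is invertible if and only if $\lambda\neq\frac{-1}{\nu_i}$ for all $i$ (the condition being vacuous for those $i$ with $\nu_i=0$).
   Context: Let $A, D \in \mathbb{R}^{m\times n}$ and $\lambda\in\mathbb{R}$. A basis $B$ is a choice of $m$ column indices such that the submatrix $A_B$ of $A$ formed by these columns is invertible; $D_B$ is the submatrix of $D$ formed by the same columns. Eigenvalues are taken in $\mathbb{C}$. *)

(* Defs.v *)
From mathcomp Require Import all_boot all_order all_algebra.
From mathcomp Require Import reals complex.
Set Implicit Arguments.
Unset Strict Implicit.
Unset Printing Implicit Defensive.
Import Order.TTheory GRing.Theory Num.Theory.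
Local Open Scope ring_scope.

(* A choice of m column indices comes with an ordering; A_B is [colsub B A]. *)
Definition is_basis (R : realType) (m n : nat) (A : 'M[R]_(m, n))
    (B : 'I_m -> 'I_n) : Prop :=
  injective B /\ colsub B A \in unitmx.

Definition basis_quotient (R : realType) (m n : nat) (A D : 'M[R]_(m, n))
    (B : 'I_m -> 'I_n) : 'M[R]_m :=
  invmx (colsub B A) *m colsub B D.

(* [nu] lists the complex eigenvalues of the real matrix M. No multiplicity is
   imposed, so the list with algebraic multiplicities is one such [nu].
   [eigenvalue] is stated with row eigenvectors; over a field this gives the
   same eigenvalues as column eigenvectors. *)
Definition complex_eigenvalues (R : realType) (m : nat) (M : 'M[R]_m)
    (nu : 'I_m -> R[i]) : Prop :=
  forall x : R[i],
    eigenvalue (map_mx (real_complex R) M) x <-> exists i : 'I_m, nu i = x.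

(* Main.v *)
Require Import Defs.
From mathcomp Require Import all_boot all_order all_algebra.
From mathcomp Require Import reals complex.
Set Implicit Arguments.
Unset Strict Implicit.
Unset Printing Implicit Defensive.
Import Order.TTheory GRing.Theory Num.Theory.
Local Open Scope ring_scope.

(** Since [A_B] is invertible, [A_B + lambda D_B = A_B (1 + lambda E)] with
    [E = A_B^-1 D_B], so the question is when [1 + lambda E] is invertible.
    For [lambda = 0] it is the identity, and [-1 / x = 0] for no [x != 0].
    For [lambda != 0] it is a nonzero multiple of [E - (- lambda^-1)], which is
    singular exactly when [- lambda^-1] is an eigenvalue of [E], and
    [lambda = -1 / x] with [x != 0] just says that [x = - lambda^-1]
    ([unitmx_1_addZ]). Invertibility does not depend on whether a real matrix
    is read over the reals or over the complex numbers, so this criterion is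
    applied over the complex numbers, where [nu] lists the eigenvalues. *)

Lemma eigenvalueE_unitmx (F : fieldType) (m : nat) (M : 'M[F]_m) (a : F) :
  eigenvalue M a = (M - a%:M \notin unitmx).
Proof. by rewrite /eigenvalue /eigenspace kermx_eq0 row_free_unit. Qed.

Lemma unitmx_1_addZ (F : fieldType) (m : nat) (M : 'M[F]_m) (c : F) :
  1%:M + c *: M \in unitmx <->
  (forall x, eigenvalue M x -> x != 0 -> c <> -1 / x).
Proof.
have [-> | c_neq0] := eqVneq c 0.
  rewrite scale0r addr0 unitmx1; split=> // _ x _ x_neq0 /eqP.
  by rewrite eq_sym mulN1r oppr_eq0 invr_eq0 (negPf x_neq0).
have -> : 1%:M + c *: M = c *: (M - (- c^-1)%:M).
  by rewrite scalerBr scale_scalar_mx mulrN divff // raddfN opprK addrC.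
rewrite unitmxZ ?unitfE // -[_ \in _]negbK -eigenvalueE_unitmx; split.
- move=> /negP not_eigen x eigen_x _ c_eq; apply: not_eigen.
  by rewrite c_eq mulN1r invrN invrK opprK.
- move=> c_neq; apply/negP => /c_neq; apply.
    by rewrite oppr_eq0 invr_eq0.
  by rewrite mulN1r invrN invrK opprK.
Qed.

Lemma unitmx_addZ_invmx (F : fieldType) (m : nat) (P Q : 'M[F]_m) (c : F) :
  P \in unitmx ->
  (P + c *: Q \in unitmx) = (1%:M + c *: (invmx P *m Q) \in unitmx).
Proof.
move=> P_unit.
have -> : P + c *: Q = P *m (1%:M + c *: (invmx P *m Q)).
  by rewrite mulmxDr mulmx1 -scalemxAr mulKVmx.
by rewrite unitmx_mul P_unit.
Qed.

Theorem theorem6 (R : realType) (m n : nat) (A D : 'M[R]_(m, n)) (lambda : R)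
    (B : 'I_m -> 'I_n) (hB : is_basis A B)
    (nu : 'I_m -> R[i]) (hnu : complex_eigenvalues (basis_quotient A D B) nu) :
  colsub B A + lambda *: colsub B D \in unitmx <->
  (forall i : 'I_m, nu i != 0 -> real_complex R lambda <> -1 / nu i).
Proof.
have [_ AB_unit] := hB.
rewrite unitmx_addZ_invmx // -(map_unitmx (real_complex R)).
rewrite map_mxD map_scalar_mx rmorph1 map_mxZ unitmx_1_addZ.
split=> lambda_neq.
- by move=> i; apply: lambda_neq; apply/hnu; exists i.
- by move=> x /hnu [i <-]; apply: lambda_neq.
Qed.
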